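(* Let $\mathcal{D}\subseteq\mathbb{R}^n$ be a convex set and, for every $\omega\in\Omega$, let $f(x,\omega)=p(x,\omega)-q(x,\omega)$ be a dc decomposition of $f(\cdot,\omega)$ on $\mathcal{D}$, i.e. $p(\cdot,\omega)$ and $q(\cdot,\omega)$ are convex on $\mathcal{D}$. Let $u(t)=\min_{1\le i\le I}(a_it+\alpha_i)$ be a concave piecewise linear utility function, for some positive integer $I$ and scalars $\{a_i,\alpha_i\}_{i=1}^I$ with each $a_i\ge 0$. Then for $x\in\mathcal{D}$, $$\mathcal{O}_u(f(x,\tilde\omega))=\Big(\sum_{i=1}^I a_i\Big)\mathbb{E}\,p(x,\tilde\omega)+\max_{\eta\in\mathbb{R}}\Big[\eta-\mathbb{E}\max_{1\le i\le I}\Big\{\Big(\sum_{i'\ne i}a_{i'}\Big)p(x,\tilde\omega)+a_i\big(q(x,\tilde\omega)+\eta\big)-\alpha_i\Big\}\Big],$$ where the first summand is a convex function of $x$ on $\mathcal{D}$ and the second summand (the maximum over $\eta$) is a concave function of $x$ on $\mathcal{D}$.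
   Context: $\tilde\omega$ is a random variable on a probability space $(\Omega,\mathcal{F},\mathbb{P})$. A utility function $u:\mathbb{R}\to[-\infty,\infty)$ here is a proper, concave, non-decreasing, lower semicontinuous function with $u(0)=0$ and $1\in\partial u(0)$ (so $u(t)\le t$ for all $t$). For an essentially bounded random variable $\mathcal{Z}$ the optimized certainty equivalent is $\mathcal{O}_u(\mathcal{Z})=\sup_{\eta\in\mathbb{R}}[\eta+\mathbb{E}\,u(\mathcal{Z}-\eta)]$. It is assumed that for each $x\in\mathcal{D}$ the random variable $f(x,\tilde\omega)$ is essentially bounded and $p(x,\tilde\omega)$, $q(x,\tilde\omega)$ are integrable. *)

(* Defs.v *)
(* MathComp / MathComp-Analysis *)
From HB Require Import structures.
From mathcomp Require Export all_boot all_order all_algebra.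
From mathcomp Require Export all_classical all_reals all_analysis.
Export Order.TTheory GRing.Theory Num.Theory.
Export numFieldNormedType.Exports.

Set Implicit Arguments.
Unset Strict Implicit.
Unset Printing Implicit Defensive.

Local Open Scope classical_set_scope.
Local Open Scope ring_scope.
Local Open Scope convex_scope.
Local Open Scope ereal_scope.

Definition concave_function (R : numFieldType) (E : lmodType R)
    (E' := convex_lmodType E) (D : set E') (f : E' -> R^o) :=
  forall t : {i01 R},
    {in D &, forall x y : E', (f x <| t |> f y <= f (x <| t |> y))%R}.

Definition dc_decomposition (R : numFieldType) (E : lmodType R)
    (D : set (convex_lmodType E)) (f p q : E -> R) : Prop :=
  [/\ convex_function D p, convex_function D q
    & forall x, x \in D -> f x = (p x - q x)%R].

Section utility.
Context (R : realType).
Implicit Type u : R -> \bar R.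

Definition proper_concave u : Prop :=
  (forall t, u t < +oo) /\ (exists t, -oo < u t).

(* For [u < +oo] no sum below is of the form [+oo - oo], and [0 * -oo = 0], so
   the endpoints [l = 0] and [l = 1] impose nothing. *)
Definition econcave u : Prop :=
  forall (l : {i01 R}) (s t : R),
    (l%:num)%:E * u s + (1 - l%:num)%:E * u t
    <= u (l%:num * s + (1 - l%:num) * t)%R.

Definition superdifferential u (x : R) : set R :=
  [set g | forall t, u t <= u x + (g * (t - x))%:E].

Definition utility u : Prop :=
  [/\ [/\ proper_concave u, econcave u & {homo u : s t / (s <= t)%R >-> s <= t}],
      lower_semicontinuous u, u 0%R = 0 & superdifferential u 0%R 1%R].

End utility.

Section oce.
Context d (T : measurableType d) (R : realType) (P : probability T R).

(* The integral replaces ['E_P[_]], which is restricted to real-valued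
   functions. *)
Definition oce (u : R -> \bar R) (Z : T -> R) : \bar R :=
  ereal_sup (range (fun eta : R => eta%:E + \int[P]_w u (Z w - eta)%R)).

(* The neutral elements [+oo] and [-oo] are irrelevant as soon as [0 < N]. *)
Definition piecewise_linear (N : nat) (a alpha : 'I_N -> R) (t : R) : \bar R :=
  \big[mine/+oo]_(i < N) (a i * t + alpha i)%:E.

Definition dc_objective (N : nat) (a alpha : 'I_N -> R) (p q : T -> R)
    (eta : R) : \bar R :=
  eta%:E - \int[P]_w \big[maxe/-oo]_(i < N)
    ((\sum_(j < N | j != i) a j) * p w + a i * (q w + eta) - alpha i)%:E.

Definition dc_sup (N : nat) (a alpha : 'I_N -> R) (p q : T -> R) : \bar R :=
  ereal_sup (range (dc_objective a alpha p q)).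

End oce.

(* Main.v *)
(* Since [u (p - q - eta) = min_i (a_i (p - q - eta) + alpha_i)], the difference
   [(sum_i a_i) p - u (p - q - eta)] is a maximum over [i] of affine functions
   of [(p, q, eta)] with nonnegative coefficients on [p] and [q].  So the two
   objectives differ by the constant [(sum_i a_i) E p], and the integrand of the
   second one is, for each outcome, jointly convex in [(x, eta)]; concavity of
   the second summand is preservation of concavity under partial maximization.
   The maximum is attained: [u t - t] is concave with maximum at [0], so for
   [|Z| <= M] moving [eta] from outside [[-M, M]] to the nearest endpoint does
   not decrease [eta + E u (Z - eta)], which is Lipschitz in [eta]. *)
Require Import Defs.
From mathcomp Require Import measurable_realfun ess_sup_inf lra.

Set Implicit Arguments.
Unset Strict Implicit.
Unset Printing Implicit Defensive.

Local Open Scope classical_set_scope.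
Local Open Scope ring_scope.
Local Open Scope ereal_scope.

(** * Attained suprema, almost-everywhere comparison of integrals, Lipschitz continuity *)

Lemma ereal_sup_range_max (R : realType) (I : Type) (g : I -> \bar R) (i0 : I) :
  (forall i, g i <= g i0) -> ereal_sup (range g) = g i0.
Proof.
move=> gi0; apply/le_anti/andP; split.
  by apply: ge_ereal_sup => _ [i _ <-].
by apply: ereal_sup_ubound; exists i0.
Qed.

(** The exceptional set lies in a measurable null set [N]; removing [N] changes neither integral and
    leaves a pointwise inequality. *)
Lemma ae_le_Rintegral d (T : measurableType d) (R : realType)
    (mu : {measure set T -> \bar R}) (f g : T -> R) :
  mu.-integrable setT (EFin \o f) -> mu.-integrable setT (EFin \o g) ->
  (\forall w \ae mu, (f w <= g w)%R) ->
  (\int[mu]_w f w <= \int[mu]_w g w)%R.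
Proof.
move=> fi gi [N [mN muN0 sub]].
have intN h : mu.-integrable setT (EFin \o h) ->
    (\int[mu]_w h w = \int[mu]_(w in ~` N) h w)%R.
  by move=> hi; rewrite /Rintegral (negligible_integral mN)// setTD.
rewrite !intN//; apply: le_Rintegral.
- exact: measurableC.
- by apply: integrableS fi => //; exact: measurableC.
- by apply: integrableS gi => //; exact: measurableC.
- by move=> w Nw; apply: contrapT => fgw; apply: Nw; apply: sub.
Qed.

Local Open Scope ring_scope.

Lemma lipschitz_continuous (R : realType) (h : R -> R) (K : R) :
  (forall s t, h s <= h t + K * `|s - t|) -> continuous h.
Proof.
move=> hK x; apply/cvgrPdist_le => /= e e0.
(* The sign of [K] is unknown; [|K| + 1] is a larger constant that is positive, so [e] can be
   divided by it. *)
have hK1 s t : h s <= h t + (`|K| + 1) * `|s - t|.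
  apply: le_trans (hK s t) _; rewrite lerD2l ler_wpM2r//.
  by apply: le_trans (ler_norm K) _; rewrite lerDl.
have K0 : 0 < `|K| + 1 by rewrite ltr_wpDl.
near=> y.
have yx : (`|K| + 1) * `|x - y| <= e.
  rewrite mulrC -ler_pdivlMr//; near: y.
  by apply: cvgr_dist_le; [exact: cvg_id|exact: divr_gt0].
rewrite ler_distlC; apply/andP; split.
  by rewrite lerBlDr; apply: le_trans (hK1 _ y) _; rewrite lerD2l.
by apply: le_trans (hK1 _ x) _; rewrite lerD2l distrC.
Unshelve. all: by end_near. Qed.

(** * Attainment of the supremum over [eta] for a real-valued utility [v] *)

Section oce_attained.
Context d (T : measurableType d) (R : realType) (P : probability T R).
Variables (v : R -> R) (K : R).
Hypothesis v_lipschitz : forall s t, v s <= v t + K * `|s - t|.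
(** Concavity between [s] and [0] with [v 0 = 0] built in: the case [l = 0] gives [0 <= v 0], and
    [v_le] gives the converse. *)
Hypothesis v_concave0 : forall l s, 0 <= l <= 1 -> l * v s <= v (l * s).
Hypothesis v_le : forall t, v t <= t.

(** Put [l = t / s]. Then [v t - t >= l * (v s - s) >= v s - s], because [v s - s <= 0] and
    [l <= 1]. *)
Lemma sub_id_le_towards0 s t : 0 <= t <= s \/ s <= t <= 0 -> v s - s <= v t - t.
Proof.
move=> st; have [s0|s0] := eqVneq s 0.
  by have -> : t = s by case: st => /andP[? ?]; apply/le_anti/andP; lra.
have l01 : 0 <= t / s <= 1.
  case: st => /andP[h1 h2].
    have s_gt0 : 0 < s by rewrite lt_neqAle eq_sym s0 (le_trans h1).
    by rewrite divr_ge0 ?(ltW s_gt0)//= ler_pdivrMr// mul1r.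
  have s_lt0 : s < 0 by rewrite lt_neqAle s0 (le_trans h1).
  rewrite -mulrNN -invrN divr_ge0 ?oppr_ge0 ?(ltW s_lt0)//=.
  by rewrite ler_pdivrMr ?oppr_gt0// mul1r lerN2.
have := v_concave0 s l01; rewrite divfK//.
have : 0 <= (1 - t / s) * (s - v s).
  by case/andP: l01 => _ ?; rewrite mulr_ge0 ?subr_ge0.
have : t / s * s = t by rewrite divfK.
nra.
Qed.

(** The Lipschitz bound together with [v 0 = 0] dominates [v (Z - eta)] by [K * (Z - eta)] in
    absolute value. *)
Lemma integrable_comp_shift (Z : T -> R) (eta : R) :
  P.-integrable setT (EFin \o Z) ->
  P.-integrable setT (EFin \o (fun w => v (Z w - eta))).
Proof.
move=> Zi.
have v0 : v 0 = 0.
  have := v_le 0; have : 0 <= (0 : R) <= 1 by rewrite lexx ler01.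
  by move=> /(v_concave0 0); rewrite !mul0r => *; apply/le_anti/andP.
have Zei : P.-integrable setT (EFin \o (fun w => K * (Z w - eta))).
  have -> : EFin \o (fun w => K * (Z w - eta)) =
      (fun w => K%:E * ((EFin \o Z) w - (EFin \o cst eta) w))%E by [].
  apply: integrableZl => //; apply: integrableB => //.
  exact: finite_measure_integrable_cst.
apply: le_integrable Zei => //.
  apply/measurable_EFinP; apply: measurableT_comp.
    apply: continuous_measurable_fun; exact: lipschitz_continuous v_lipschitz.
  apply: measurable_funB => //.
  by have /measurable_int/measurable_EFinP := Zi.
move=> w _ /=; rewrite lee_fin normrM ler_norml.
set s := Z w - eta.
have := v_lipschitz s 0; have := v_lipschitz 0 s.
rewrite v0 !(subr0, sub0r, normrN) => h1 h2.
have : K * `|s| <= `|K| * `|s| by rewrite ler_wpM2r// ler_norm.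
by move=> ?; apply/andP; split; lra.
Qed.

Lemma oce_attained (Z : T -> R) (M : R) :
  P.-integrable setT (EFin \o Z) -> (\forall w \ae P, `|Z w| <= M) ->
  exists eta0, forall eta,
    eta + \int[P]_w v (Z w - eta) <= eta0 + \int[P]_w v (Z w - eta0).
Proof.
move=> Zi ZM; pose h eta := eta + \int[P]_w v (Z w - eta).
(* The slack [c] serves two uses: [c = (1 + K) * |s - t|] makes [h] Lipschitz, and [c = 0] compares
   [eta] with an endpoint. Total mass [1] lets the constant pass through the integral. *)
have h_le eta eta' c :
    (\forall w \ae P, v (Z w - eta) <= v (Z w - eta') + (eta' - eta + c)) ->
    h eta <= h eta' + c.
  move=> le_v; suff : \int[P]_w v (Z w - eta) <=
      \int[P]_w v (Z w - eta') + (eta' - eta + c) by rewrite /h; lra.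
  have ci := @finite_measure_integrable_cst _ _ _ P setT (eta' - eta + c)
    measurableT.
  have vi := integrable_comp_shift.
  apply: le_trans (_ : _ <= \int[P]_w (v (Z w - eta') + (eta' - eta + c))) _.
    apply: ae_le_Rintegral => //; first exact: vi.
    exact (integrableD measurableT (vi _ eta' Zi) ci).
  rewrite (RintegralD measurableT (vi _ eta' Zi) ci)/=.
  have PT1 : fine (P setT) = 1 by rewrite probability_setT.
  by rewrite Rintegral_cst// [X in _ * X]PT1 mulr1.
have h_lip s t : h s <= h t + (1 + K) * `|s - t|.
  apply: h_le; apply: nearW => w.
  have := v_lipschitz (Z w - s) (Z w - t).
  have -> : Z w - s - (Z w - t) = t - s by lra.
  rewrite [`|s - t|]distrC => /le_trans; apply.
  have := ler_norm (s - t); rewrite distrC; lra.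
(* [M] may be negative, so the compact interval is built from [|M|]. *)
have MM : - `|M| <= `|M| by rewrite ge0_cp.
have hc := continuous_subspaceT (lipschitz_continuous h_lip).
have [eta0 _ eta0P] := EVT_max MM (hc _).
exists eta0 => eta; rewrite -!/(h _).
have M_in : `|M| \in `[- `|M|, `|M|] by rewrite in_itv/= MM lexx.
have NM_in : - `|M| \in `[- `|M|, `|M|] by rewrite in_itv/= MM lexx.
(* Almost surely [0 <= Z + |M| <= Z - eta] here, so moving [eta] up to [-|M|] pulls the argument of
   [v] towards [0]; the case [eta > |M|] is symmetric. *)
have [eta_lt|eta_ge] := ltP eta (- `|M|).
  apply: le_trans (eta0P _ NM_in); rewrite -[leRHS]addr0; apply: h_le.
  apply: filterS ZM => w /le_trans/(_ (ler_norm M)).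
  rewrite ler_norml => /andP[? ?].
  suff : v (Z w - eta) - (Z w - eta) <=
      v (Z w - - `|M|) - (Z w - - `|M|) by lra.
  by apply: sub_id_le_towards0; left; apply/andP; split; lra.
have [eta_gt|eta_le] := ltP `|M| eta; last first.
  by apply: eta0P; rewrite in_itv/= eta_ge.
apply: le_trans (eta0P _ M_in); rewrite -[leRHS]addr0; apply: h_le.
apply: filterS ZM => w /le_trans/(_ (ler_norm M)).
rewrite ler_norml => /andP[? ?].
suff : v (Z w - eta) - (Z w - eta) <= v (Z w - `|M|) - (Z w - `|M|) by lra.
by apply: sub_id_le_towards0; right; apply/andP; split; lra.
Qed.

End oce_attained.

(** * Minima of finitely many affine pieces *)

Section piecewise_linear.
Context (R : realType) (N : nat) (a alpha : 'I_N -> R).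
Hypothesis N_gt0 : (0 < N)%N.
Local Notation v := (fun t => fine (piecewise_linear a alpha t)).

(** The estimates below take the piece active at one point and use it as an upper bound of the
    minimum at other points. *)
Lemma piecewise_linear_argmin t : exists2 i,
  piecewise_linear a alpha t = (a i * t + alpha i)%:E &
  forall j, a i * t + alpha i <= a j * t + alpha j.
Proof.
pose i0 := Ordinal N_gt0.
have [i _ imin] := @Order.TotalTheory.arg_minP _ _ _ i0 xpredT
  (fun i => a i * t + alpha i) erefl.
exists i => [|j]; last exact: imin.
apply/le_anti/andP; split; first exact: bigmin_le.
apply: le_bigmin => [|j _]; first exact: leey.
by rewrite lee_fin imin.
Qed.

Lemma piecewise_linear_fin_num t : piecewise_linear a alpha t \is a fin_num.
Proof. by have [i ->] := piecewise_linear_argmin t. Qed.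

Lemma piecewise_linear_lipschitz (a_ge0 : forall i, 0 <= a i) s t :
  v s <= v t + (\sum_(i < N) a i) * `|s - t|.
Proof.
have [j sj] := piecewise_linear_argmin s.
have [i ti] := piecewise_linear_argmin t.
(* The piece [i] active at [t] bounds [v s] from above, and its slope is at most the sum of all
   slopes. *)
rewrite sj ti /= => _ /(_ i) /le_trans; apply.
have : a i * (s - t) <= a i * `|s - t| by rewrite ler_wpM2l// ler_norm.
have : a i * `|s - t| <= (\sum_(i < N) a i) * `|s - t|.
  by rewrite ler_wpM2r// (bigD1 i)//= lerDl sumr_ge0.
lra.
Qed.

Lemma dc_integrandE (x y eta : R) :
  \big[maxe/-oo%E]_(i < N)
    ((\sum_(j < N | j != i) a j) * x + a i * (y + eta) - alpha i)%:E =
  ((\sum_(i < N) a i) * x - v (x - y - eta))%:E.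
Proof.
have [i /[dup] vi -> imin] := piecewise_linear_argmin (x - y - eta).
(* Each term is the same quantity minus the [j]-th piece, so the maximum turns into minus a
   minimum. *)
have dcE j : (\sum_(k < N | k != j) a k) * x + a j * (y + eta) - alpha j =
    (\sum_(k < N) a k) * x - (a j * (x - y - eta) + alpha j).
  by rewrite [\sum_(k < N) a k](bigD1 j)//=; lra.
apply/le_anti/andP; split.
  by apply: bigmax_le => [|j _]; rewrite ?leNye// lee_fin dcE/= lerB.
by apply: le_trans (le_bigmax _ _ i); rewrite lee_fin dcE.
Qed.

(* The left-hand side is a maximum of functions of [(x, y, eta)] that are
   linear and nondecreasing in [x] and [y]. *)
Lemma dc_integrand_convex (a_ge0 : forall i, 0 <= a i) (l : R)
    (x x1 x2 y y1 y2 eta1 eta2 : R) (A := \sum_(i < N) a i) :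
  0 <= l <= 1 ->
  x <= l * x1 + (1 - l) * x2 -> y <= l * y1 + (1 - l) * y2 ->
  A * x - v (x - y - (l * eta1 + (1 - l) * eta2)) <=
  l * (A * x1 - v (x1 - y1 - eta1)) +
  (1 - l) * (A * x2 - v (x2 - y2 - eta2)).
Proof.
move=> /andP[l0 l1] xle yle.
(* With [i] active at the combined point, the left-hand side is affine with coefficients [A - a i]
   on [x] and [a i] on [y]; the same piece bounds [v] from above at both endpoints. *)
have [i -> _] :=
  piecewise_linear_argmin (x - y - (l * eta1 + (1 - l) * eta2)).
have [i1 -> /(_ i) le1] := piecewise_linear_argmin (x1 - y1 - eta1).
have [i2 -> /(_ i) le2] := piecewise_linear_argmin (x2 - y2 - eta2).
have ai_leA : 0 <= A - a i.
  by rewrite /A (bigD1 i)//= [a i + _]addrC addrK sumr_ge0.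
have l1' : 0 <= 1 - l by rewrite subr_ge0.
move: (ler_wpM2l ai_leA xle) (ler_wpM2l (a_ge0 i) yle).
move: (ler_wpM2l l0 le1) (ler_wpM2l l1' le2) => /=.
move: (a i) (alpha i) (a i1 * _ + _) (a i2 * _ + _) A
  {le1 le2 ai_leA l0 l1 l1' xle yle} => b c d1 d2 B; clear; lra.
Qed.

Lemma utility_concave0 (u : R -> \bar R) :
  utility u -> (forall t, u t = piecewise_linear a alpha t) ->
  forall l s, 0 <= l <= 1 -> l * v s <= v (l * s).
Proof.
move=> [[_ u_concave _] _ u0 _] u_pl l s l01.
(* The second point is [0], where [u] vanishes, so only the term in [s] survives. *)
have := u_concave (Itv01 (andP l01).1 (andP l01).2) s 0.
rewrite -lee_fin EFinM !fineK ?piecewise_linear_fin_num// -!u_pl.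
by rewrite /= u0 mule0 adde0 mulr0 addr0.
Qed.

Lemma utility_le (u : R -> \bar R) :
  utility u -> (forall t, u t = piecewise_linear a alpha t) ->
  forall t, v t <= t.
Proof.
move=> [_ _ u0 u1] u_pl t; have := u1 t.
by rewrite u0 add0e mul1r subr0 u_pl -lee_fin fineK ?piecewise_linear_fin_num.
Qed.

End piecewise_linear.

Local Open Scope ereal_scope.

(** * The decomposition of the certainty equivalent and the curvature of its summands *)

Theorem proposition2 (R : realType) (d : measure_display) (T : measurableType d)
    (P : probability T R) (n : nat) (D : set 'rV[R]_n)
    (f p q : 'rV[R]_n -> T -> R)
    (N : nat) (a alpha : 'I_N -> R) (u : R -> \bar R)
    (D_convex : convex_set D)
    (f_dc : forall w : T, dc_decomposition D (f^~ w) (p^~ w) (q^~ w))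
    (f_bounded : forall x, x \in D -> f x \in Lfun P +oo)
    (p_int : forall x, x \in D -> P.-integrable [set: T] (EFin \o p x))
    (q_int : forall x, x \in D -> P.-integrable [set: T] (EFin \o q x))
    (N_gt0 : (0 < N)%N)
    (a_ge0 : forall i, (0 <= a i)%R)
    (u_utility : utility u)
    (u_pl : forall t, u t = piecewise_linear a alpha t) :
  let first_summand x := (\sum_(i < N) a i)%:E * 'E_P[p x] in
  let second_summand x := dc_sup P a alpha (p x) (q x) in
  [/\ forall x, x \in D ->
        [/\ oce P u (f x) = first_summand x + second_summand x,
            first_summand x \is a fin_num,
            second_summand x \is a fin_num
          & exists eta : R,
              dc_objective P a alpha (p x) (q x) eta = second_summand x],
      convex_function D (fun x => fine (first_summand x))
    & concave_function D (fun x => fine (second_summand x))].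
Proof.
move=> first_summand second_summand.
pose A := (\sum_(i < N) a i)%R.
pose v t := fine (piecewise_linear a alpha t).
have v_lip : forall s t, (v s <= v t + A * `|s - t|)%R.
  exact: piecewise_linear_lipschitz.
have v_concave0 := utility_concave0 N_gt0 u_utility u_pl :
  forall l s, (0 <= l <= 1 -> l * v s <= v (l * s))%R.
have v_le := utility_le N_gt0 u_utility u_pl : forall t, (v t <= t)%R.
have uE t : u t = (v t)%:E by rewrite fineK ?piecewise_linear_fin_num.
have fE x w : x \in D -> f x w = (p x w - q x w)%R.
  by move=> xD; have [_ _ ->] := f_dc w.
have f_int x : x \in D -> P.-integrable setT (EFin \o f x).
  move=> xD; have := integrableB measurableT (p_int _ xD) (q_int _ xD).
  by apply: eq_integrable => // w _ /=; rewrite fE.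
have firstE x : x \in D -> first_summand x = (A * \int[P]_w p x w)%:E.
  move=> xD; rewrite /first_summand expectation.unlock EFinM fineK//.
  exact (integrable_fin_num measurableT (p_int _ xD)).
have v_int x eta : x \in D ->
    P.-integrable setT (EFin \o (fun w => v (f x w - eta)%R)).
  move=> xD.
  exact (integrable_comp_shift v_lip v_concave0 v_le eta (f_int _ xD)).
have Ap_int x : x \in D -> P.-integrable setT (EFin \o (fun w => A * p x w)%R).
  by move=> xD; have := integrableZl measurableT A (p_int _ xD).
(* By [dc_integrandE], this is the integrand of [dc_objective] for [x] in [D], in real-valued
   form. *)
pose C x eta w := (A * p x w - v (f x w - eta))%R.
have C_int x eta : x \in D -> P.-integrable setT (EFin \o C x eta).
  by move=> xD; have := integrableB measurableT (Ap_int _ xD) (v_int _ eta xD).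
have objE x eta : x \in D -> dc_objective P a alpha (p x) (q x) eta =
    (eta - \int[P]_w C x eta w)%:E.
  move=> xD; rewrite /dc_objective EFinB fineK; last first.
    exact (integrable_fin_num measurableT (C_int _ eta xD)).
  congr (_ - _); apply: eq_integral => w _.
  by rewrite dc_integrandE// /C fE.
have CE x eta : x \in D ->
    (\int[P]_w C x eta w = A * \int[P]_w p x w - \int[P]_w v (f x w - eta))%R.
  move=> xD; rewrite RintegralB ?RintegralZl//.
  - exact: p_int.
  - exact: Ap_int.
  - exact: v_int.
have oceE x eta : x \in D -> eta%:E + \int[P]_w u (f x w - eta)%R =
    (eta + \int[P]_w v (f x w - eta))%:E.
  move=> xD; rewrite EFinD fineK; last first.
    exact (integrable_fin_num measurableT (v_int _ eta xD)).
  by congr (_ + _); apply: eq_integral => w _; rewrite uE.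
(* By [CE] the two objectives differ by [A * \int[P]_w p x w], free of [eta], so one [eta0]
   maximizes both. *)
have attained x : x \in D -> exists2 eta0,
    oce P u (f x) = (eta0 + \int[P]_w v (f x w - eta0))%:E &
    forall eta, (eta - \int[P]_w C x eta w <= eta0 - \int[P]_w C x eta0 w)%R.
  move=> xD.
  have [M fM] : exists M : R, \forall w \ae P, (`|f x w| <= M)%R.
    have : 'N[P]_+oo[EFin \o f x] < +oo.
      by have := sub_Lfun_finLfun (f_bounded _ xD); rewrite inE.
    (* The norm of exponent [+oo] is an essential supremum once the space has positive mass, here
       [1]. *)
    rewrite unlock /Lnorm [X in X > 0]probability_setT lte01.
    exact: ess_supr_bounded.
  have [eta0 eta0P] := oce_attained v_lip v_concave0 v_le (f_int _ xD) fM.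
  exists eta0 => [|eta]; last by have := eta0P eta; rewrite !CE//; lra.
  rewrite -(oceE _ _ xD) /oce (ereal_sup_range_max (i0 := eta0))// => eta.
  by rewrite !oceE// lee_fin.
have secondE x eta0 : x \in D ->
    (forall eta, eta - \int[P]_w C x eta w <= eta0 - \int[P]_w C x eta0 w)%R ->
    second_summand x = (eta0 - \int[P]_w C x eta0 w)%:E.
  move=> xD eta0P; rewrite -objE//; apply: ereal_sup_range_max => eta.
  by rewrite !objE// lee_fin.
have convE (l : {i01 R}) (b c : R^o) :
  conv l b c = (l%:num * b + (1 - l%:num) * c)%R by [].
split.
- move=> x xD; have [eta0 oceP eta0P] := attained _ xD.
  rewrite firstE// (secondE _ _ xD eta0P) oceP; split=> //.
    by rewrite -EFinD CE//; congr EFin; lra.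
  by exists eta0; rewrite objE.
- move=> l x y xD yD; have xyD := D_convex _ _ l xD yD.
  rewrite !firstE//= convE.
  have A_ge0 : (0 <= A)%R by rewrite sumr_ge0.
  rewrite [leRHS](_ : _ = A * (l%:num * \int[P]_w p x w +
    (1 - l%:num)%R * \int[P]_w p y w))%R; last by lra.
  rewrite ler_wpM2l// -!RintegralZl//; [|exact: p_int|exact: p_int].
  have px_int := integrableZl measurableT l%:num (p_int _ xD).
  have py_int := integrableZl measurableT (1 - l%:num)%R (p_int _ yD).
  rewrite -RintegralD//; apply: le_Rintegral => //; first exact: p_int.
    exact: integrableD px_int py_int.
  by move=> w _; have [/(_ l _ _ xD yD) + _ _] := f_dc w.
- move=> l x y xD yD; have xyD := D_convex _ _ l xD yD.
  have [eta1 _ eta1P] := attained _ xD.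
  have [eta2 _ eta2P] := attained _ yD.
  have [eta0 _ eta0P] := attained _ xyD.
  rewrite (secondE _ _ xD eta1P) (secondE _ _ yD eta2P).
  rewrite (secondE _ _ xyD eta0P) convE/=.
  (* Partial maximization: the optimal value at the combined point is at least the objective at the
     same combination of the maximizers [eta1] and [eta2], and joint convexity of the integrand in
     [(x, eta)] finishes. *)
  apply: le_trans (eta0P (l%:num * eta1 + (1 - l%:num) * eta2)%R).
  have Cx_int := integrableZl measurableT l%:num (C_int _ eta1 xD).
  have Cy_int := integrableZl measurableT (1 - l%:num)%R (C_int _ eta2 yD).
  suff : (\int[P]_w C (conv l x y) (l%:num * eta1 + (1 - l%:num) * eta2) w <=
      l%:num * \int[P]_w C x eta1 w + (1 - l%:num) * \int[P]_w C y eta2 w)%R.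
    by lra.
  rewrite -!RintegralZl//; [|exact: C_int|exact: C_int].
  rewrite -RintegralD//; apply: le_Rintegral => //; first exact: C_int.
    exact: integrableD Cx_int Cy_int.
  move=> w _; rewrite /C !fE//; apply: dc_integrand_convex => //.
  + by apply/andP.
  + by have [/(_ l _ _ xD yD) + _ _] := f_dc w.
  + by have [_ /(_ l _ _ xD yD) + _] := f_dc w.
Qed.
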